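(* Let $\zeta=e^{\pi\mathrm i/6}$ and $h=\zeta^2=e^{\pi\mathrm i/3}$. The operator $$R=\frac{\mathrm i\zeta}{2}\bigl(I_{16}+U+V+UV\bigr)\in\mathrm{End}(W\otimes W)$$ is unitary and satisfies the Yang--Baxter equation. It also satisfies $(R+I_{16})(R-hI_{16})=0$, and the two eigenvalues $-1$ and $h$ both have multiplicity $8$.
   Context: Let $K=\mathbb C^2$ with orthonormal basis $e_j$, $j\in\mathbb Z/2\mathbb Z$, $Xe_j=e_{j+1}$, $Ze_j=(-1)^je_j$, and $W=K\otimes K$. On $W\otimes W=(K\otimes K)\otimes(K\otimes K)$ put $P_Z=(I\otimes Z)\otimes(Z\otimes I)$, $P_X=(X\otimes I)\otimes(X\otimes X)$, $U=\mathrm iP_Z$, $V=\mathrm iP_X$. The Yang--Baxter equation is $(R\otimes I_W)(I_W\otimes R)(R\otimes I_W)=(I_W\otimes R)(R\otimes I_W)(I_W\otimes R)$ on $W^{\otimes3}$. *)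

(* Defs.v *)
From HB Require Import structures.
From mathcomp Require Import all_boot all_order all_algebra.
From mathcomp Require Import reals sequences exp trigo.
From mathcomp Require Import complex mxtens.

Set Implicit Arguments.
Unset Strict Implicit.
Unset Printing Implicit Defensive.

Import Order.TTheory GRing.Theory Num.Theory.
Local Open Scope ring_scope.
Local Open Scope complex_scope.

(* exp (x + i y) = exp x * (cos y + i sin y) *)
Definition cexp (R : realType) (z : R[i]) : R[i] :=
  (expR (complex.Re z))%:C * (cos (complex.Im z) +i* sin (complex.Im z)).

(* Operators are represented by their matrices acting on column vectors in the
   standard orthonormal bases (column j is the image of e_j), so composition is
   [*m] and the tensor product is the Kronecker product [*t], with the basis of
   a tensor product ordered lexicographically.  Indices in 'I_2 = 'Z_2 are added
   modulo 2. *)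
Definition shiftX (R : realType) : 'M[R[i]]_2 :=
  \matrix_(i, j) (i == j + 1)%:R.

Definition clockZ (R : realType) : 'M[R[i]]_2 :=
  \matrix_(i, j) ((-1) ^+ j *+ (i == j)).

Definition opPZ (R : realType) : 'M[R[i]]_((2 * 2) * (2 * 2)) :=
  (1%:M *t clockZ R) *t (clockZ R *t 1%:M).

Definition opPX (R : realType) : 'M[R[i]]_((2 * 2) * (2 * 2)) :=
  (shiftX R *t 1%:M) *t (shiftX R *t shiftX R).

Definition opU (R : realType) : 'M[R[i]]_((2 * 2) * (2 * 2)) :=
  'i%C *: opPZ R.

Definition opV (R : realType) : 'M[R[i]]_((2 * 2) * (2 * 2)) :=
  'i%C *: opPX R.

(* [castmx] identifies W * (W * W) with (W * W) * W, i.e. it casts along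
   n * (n * n) = n * n * n; by the lexicographic ordering this is the
   associator on basis vectors. *)
Definition yang_baxter (F : comPzRingType) (n : nat) (A : 'M[F]_(n * n)) : Prop :=
  let A12 : 'M[F]_(n * n * n) := A *t (1%:M : 'M[F]_n) in
  let A23 : 'M[F]_(n * n * n) :=
    castmx (mulnA n n n, mulnA n n n) ((1%:M : 'M[F]_n) *t A) in
  A12 *m A23 *m A12 = A23 *m A12 *m A23.

(* Main.v *)
(* U and V anticommute and square to -1, so they generate a quaternion algebra
   and R = (i zeta / 2) (1 + q) with q = U + V + UV, q^2 = -3: the quadratic
   equation and unitarity are identities in this algebra.  U, V and UV are
   traceless because each anticommutes with an operator of square -1; hence
   tr R = 8 (h - 1), which determines the two multiplicities.  On the triple
   tensor product the two copies (U1, V1) and (U2, V2) satisfy: U1 commutes with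
   U2, V1 commutes with V2, and U1, V2 as well as V1, U2 anticommute.  In any
   ring these relations imply the braid relation, by conjugation. *)

Require Import Defs.
From HB Require Import structures.
From mathcomp Require Import all_boot all_order all_algebra.
From mathcomp Require Import reals sequences exp trigo.
From mathcomp Require Import complex mxtens ring lra.

Set Implicit Arguments.
Unset Strict Implicit.
Unset Printing Implicit Defensive.

Import Order.TTheory GRing.Theory Num.Theory.
Local Open Scope ring_scope.
Local Open Scope complex_scope.

(** * Anticommuting square roots of -1 and the braid relation in an arbitrary ring *)

Section Quaternion.
Variable T : pzRingType.

Lemma add1_mul_anticomm (x y : T) :
  x * y = - (y * x) -> (1 + x) * y = y * (1 - x).
Proof. by move=> xy; rewrite mulrDl mulrBr mul1r mulr1 xy. Qed.

Lemma mul_add1_anticomm (x y : T) :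
  x * y = - (y * x) -> x * (1 + y) = (1 - y) * x.
Proof. by move=> xy; rewrite mulrDr mulrBl mul1r mulr1 xy. Qed.

Lemma sqrD_anticomm (x y : T) :
  x * y = - (y * x) -> (x + y) * (x + y) = x * x + y * y.
Proof. by move=> xy; rewrite mulrDl !mulrDr xy addrA addrNK. Qed.

(** In factored form a generator passes each factor [1 + x] with at most a change to [1 - x], which
    avoids expanding products of four-term sums. *)
Lemma quaternion_factor (u v : T) : 1 + u + v + u * v = (1 + u) * (1 + v).
Proof. by rewrite mulrDr mulr1 mulrDl mul1r !addrA. Qed.

(** The elements [u], [v] and [u * v] anticommute pairwise and each squares to -1, so the cross
    terms cancel and three squares remain. *)
Lemma quaternion_pure_sqr (u v : T) :
  u * u = -1 -> v * v = -1 -> u * v = - (v * u) ->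
  (u + v + u * v) * (u + v + u * v) = - 3%:R.
Proof.
move=> uu vv uv; have uvu : u * v * u = v.
  by rewrite uv mulNr -mulrA uu mulrN1 opprK.
rewrite sqrD_anticomm; last first.
  rewrite mulrDl mulrDr uvu -[u * v * v]mulrA vv mulrN1 mulrA uu mulN1r.
  by rewrite {1}uv mulrN mulrA vv mulN1r !opprK opprD opprK addrC.
by rewrite sqrD_anticomm // mulrA uvu uu vv -!opprD -addrA.
Qed.

(* Conjugation by q1 q2 maps u1 to u2 v2 and v1 to u2, hence u1 v1 to v2, so it
   carries q1 to q2. *)
Lemma quaternion_braid (u1 v1 u2 v2 : T) :
  u1 * u1 = -1 -> v1 * v1 = -1 -> u2 * u2 = -1 -> v2 * v2 = -1 ->
  u1 * v1 = - (v1 * u1) -> u2 * v2 = - (v2 * u2) ->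
  u1 * u2 = u2 * u1 -> v1 * v2 = v2 * v1 ->
  u1 * v2 = - (v2 * u1) -> v1 * u2 = - (u2 * v1) ->
  let q1 := 1 + u1 + v1 + u1 * v1 in
  let q2 := 1 + u2 + v2 + u2 * v2 in
  q1 * q2 * q1 = q2 * q1 * q2.
Proof.
move=> uu1 vv1 uu2 vv2 uv1 uv2 u12 v12 uv12 vu12 q1 q2.
have swap (x y : T) : x = - y -> y = - x by move->; rewrite opprK.
have comm1 (x y : T) : x * y = y * x -> (1 + x) * y = y * (1 + x).
  by move=> xy; rewrite mulrDl mulrDr mul1r mulr1 xy.
have commB (x y : T) : x * y = y * x -> (1 - x) * y = y * (1 - x).
  by move=> xy; rewrite mulrBl mulrBr mul1r mulr1 xy.
have absl (x : T) : x * x = -1 -> x * (1 + x) = - (1 - x).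
  by move=> xx; rewrite mulrDr mulr1 xx opprB.
have absr (x : T) : x * x = -1 -> (1 + x) * x = - (1 - x).
  by move=> xx; rewrite mulrDl mul1r xx opprB.
have abslB (x : T) : x * x = -1 -> x * (1 - x) = 1 + x.
  by move=> xx; rewrite mulrBr mulr1 xx opprK addrC.
(* The conjugation is written as an intertwining relation, meaningful in any ring. Moving [u1] left
   until [1 + u1] absorbs it, and [v2], then [u2], right until [1 + v2] and [1 - u2] absorb them,
   gives the same product of four factors. *)
have e1 : q1 * q2 * u1 = u2 * v2 * (q1 * q2).
  have -> : q1 * q2 * u1 = - ((1 - u1) * (1 - v1) * (1 + u2) * (1 - v2)).
    rewrite /q1 /q2 !quaternion_factor -!mulrA (@add1_mul_anticomm v2 u1);
      last exact: swap.
    rewrite (mulrA (1 + u2)) (comm1 _ _ (esym u12)) !mulrA -(mulrA (1 + u1)).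
    rewrite (@add1_mul_anticomm v1 u1); last exact: swap.
    by rewrite mulrA absr // !mulNr.
  rewrite /q1 /q2 !quaternion_factor -!mulrA (mulrA v2).
  rewrite (@mul_add1_anticomm v2 u1); last exact: swap.
  rewrite -!mulrA (mulrA v2) -(comm1 _ _ v12) -!mulrA (mulrA v2).
  rewrite (@mul_add1_anticomm v2 u2); last exact: swap.
  rewrite -!mulrA absl // !mulrN; congr (- _).
  rewrite (mulrA u2) -(commB _ _ u12) -!mulrA (mulrA u2).
  rewrite (@mul_add1_anticomm u2 v1); last exact: swap.
  by rewrite -!mulrA (mulrA u2) abslB.
have e2 : q1 * q2 * v1 = u2 * (q1 * q2).
  have -> : q1 * q2 * v1 = - ((1 + u1) * (1 - v1) * (1 - u2) * (1 + v2)).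
    rewrite /q1 /q2 !quaternion_factor -!mulrA (comm1 _ _ (esym v12)).
    rewrite (mulrA (1 + u2)) (@add1_mul_anticomm u2 v1); last exact: swap.
    by rewrite -!mulrA (mulrA (1 + v1)) absr // !mulNr !mulrN.
  rewrite /q1 /q2 !quaternion_factor -!mulrA (mulrA u2) -(comm1 _ _ u12).
  rewrite -!mulrA (mulrA u2) (@mul_add1_anticomm u2 v1); last exact: swap.
  by rewrite -!mulrA (mulrA u2) absl // !mulNr !mulrN.
have uvu2 : u2 * v2 * u2 = v2.
  by rewrite uv2 mulNr -mulrA uu2 mulrN1 opprK.
(* The term [u1 * v1] passes to [u2 * v2 * u2 = v2], so the terms of [q1] become those of [q2] in
   another order. *)
have -> : q1 * q2 * q1 = (1 + u2 * v2 + u2 + v2) * (q1 * q2).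
  rewrite {2}/q1; move: (q1 * q2) e1 e2 => g e1 e2.
  by rewrite !mulrDr !mulrDl mulr1 mul1r mulrA e1 -(mulrA _ g) e2 mulrA uvu2.
by rewrite -mulrA; congr (_ * _); rewrite 2!(addrAC _ (u2 * v2)).
Qed.

End Quaternion.

(** * Traces, ranks and eigenvalue multiplicities *)

(** By cyclicity of the trace, moving one [N] around [M] shows that [\tr (M *m N *m N)] equals its
    own negative. *)
Lemma mxtrace_anticomm (F : numDomainType) n (M N : 'M[F]_n) :
  N *m N = - 1%:M -> M *m N = - (N *m M) -> \tr M = 0.
Proof.
move=> NN MN; have: \tr (M *m N *m N) = - \tr (M *m N *m N).
  by rewrite {1}MN mulNmx raddfN /= -(mulmxA N) mxtrace_mulC.
rewrite -mulmxA NN mulmxN mulmx1 raddfN opprK => /eqP /=.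
by rewrite eqNr => /eqP.
Qed.

(** In the rank factorization [B = C *m D], cancelling the full-rank factors in [B *m B = c *: B]
    leaves [D *m C = c%:M], a scalar matrix of size [\rank B] with the same trace as [B]. *)
Lemma mxtrace_quasi_idempotent (F : fieldType) n (B : 'M[F]_n) (c : F) :
  B *m B = c *: B -> \tr B = c * (\rank B)%:R.
Proof.
move=> BB; have DC : row_base B *m col_base B = c%:M.
  apply: (row_free_inj (row_base_free B)).
  apply: (row_full_inj (col_base_full B)).
  rewrite /= -(mulmxA (row_base B)) mulmx_base mulmxA mulmx_base BB.
  by rewrite mul_scalar_mx -scalemxAr mulmx_base.
by rewrite -{1}(mulmx_base B) mxtrace_mulC DC mxtrace_scalar mulr_natr.
Qed.

(* The two counts k and l are determined by the size and the trace of A. *)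
Lemma two_eigenvalue_multiplicity (F : numClosedFieldType) n k l
    (A : 'M[F]_n) (a b : F) :
  a != b -> n = (k + l)%N -> (A - a%:M) *m (A - b%:M) = 0 ->
  \tr A = a *+ k + b *+ l ->
  mup a (char_poly A) = k /\ \rank (eigenspace A^T a) = k.
Proof.
move=> neq_ab nE Aab trA; split.
  have [s sE] := closed_field_poly_normal (char_poly A).
  rewrite (monicP (char_poly_monic A)) scale1r in sE.
  have size_s : size s = n.
    by have := size_char_poly A; rewrite sE size_prod_XsubC => -[].
  have s_ab z : z \in s -> z = a \/ z = b.
    move=> zs; have: root (char_poly A) z by rewrite sE root_prod_XsubC.
    rewrite -eigenvalue_root_char => /eigenvalueP[v vA v0].
    have: v *m ((A - a%:M) *m (A - b%:M)) = 0 by rewrite Aab mulmx0.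
    rewrite mulmxA (mulmxBr v) mul_mx_scalar vA -scalerBl -scalemxAl mulmxBr.
    rewrite mul_mx_scalar vA -scalerBl scalerA => /eqP.
    rewrite scaler_eq0 (negPf v0) orbF mulf_eq0.
    by rewrite !subr_eq0 => /orP[] /eqP; [left | right].
  have sum_s : \sum_(z <- s) z = \tr A.
    (* The trace is minus the coefficient of degree [n - 1], which needs [n > 0]; for [n = 0] both
       sums are empty. *)
    have [n0|n_gt0] := posnP n.
      have -> : s = [::] by apply: size0nil; rewrite size_s.
      rewrite big_nil /mxtrace big1 // => -[i lt_in].
      by exfalso; rewrite n0 in lt_in.
    apply: oppr_inj; rewrite -(char_poly_trace A n_gt0) sE -size_s.
    by rewrite coefPn_prod_XsubC // size_s -lt0n.
  (* In the sum of [z - b] over the roots, each [a] contributes [a - b] and each [b] contributes 0,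
     so the trace yields the number of occurrences of [a]. *)
  rewrite sE mu_prod_XsubC; apply: (@mulrIn _ (a - b)); first by rewrite subr_eq0.
  have -> : (a - b) *+ count_mem a s = \sum_(z <- s) (z - b).
    rewrite -sum1_count -sumrMnr big_mkcond; apply: eq_big_seq => z /s_ab[] ->.
      by rewrite /= eqxx.
    by rewrite /= eq_sym (negPf neq_ab) subrr.
  rewrite sumrB sum_s trA big_const_seq count_predT size_s iter_addr_0 nE.
  by rewrite mulrnDr mulrnBl opprD addrA addrAC addrK.
(* The matrix [B = A - y%:M] satisfies [B *m B = (x - y) *: B], so its trace determines its rank. *)
have quasi x y j m : n = (j + m)%N -> \tr A = x *+ j + y *+ m -> x != y ->
    (A - x%:M) *m (A - y%:M) = 0 -> \rank (A - y%:M) = j.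
  move=> nE' tr' neq_xy Axy.
  have trB : \tr (A - y%:M) = (x - y) *+ j.
    rewrite raddfB /= tr' mxtrace_scalar nE' mulrnDr opprD addrA addrAC addrK.
    by rewrite -mulrnBl.
  have sqB : (A - y%:M) *m (A - y%:M) = (x - y) *: (A - y%:M).
    apply/eqP; rewrite -subr_eq0 -mul_scalar_mx -mulmxBl.
    by rewrite (raddfB (@scalar_mx F n)) /= opprB addrA addrNK Axy.
  have xy0 : x - y != 0 by rewrite subr_eq0.
  have := mxtrace_quasi_idempotent sqB.
  by rewrite trB mulr_natr => /(mulrIn xy0).
have Aba : (A - b%:M) *m (A - a%:M) = 0.
  rewrite -Aab; apply/esym/comm_mxB; last exact: comm_mx_scalar.
  by apply/comm_mx_sym/comm_mxB; last exact: comm_mx_scalar.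
have rk : \rank (A - a%:M) = l.
  apply: (quasi b a l k) => //; first by rewrite addnC.
    by rewrite addrC.
  by rewrite eq_sym.
(* Rank-nullity; the transpose turns row eigenvectors into column eigenvectors of [A]. *)
rewrite /eigenspace mxrank_ker -tr_scalar_mx -(raddfB (@trmx F n n)) mxrank_tr rk.
by rewrite nE addnK.
Qed.

(** * Kronecker products, the associator and the Yang-Baxter equation *)

Lemma castmxD (F : nmodType) m n m' n' (e : (m = m') * (n = n'))
    (A B : 'M[F]_(m, n)) :
  castmx e (A + B) = castmx e A + castmx e B.
Proof. by case: e => em en; case: m' / em; case: n' / en. Qed.

Lemma castmxZ (F : pzRingType) m n m' n' (e : (m = m') * (n = n')) (c : F)
    (A : 'M[F]_(m, n)) :
  castmx e (c *: A) = c *: castmx e A.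
Proof. by case: e => em en; case: m' / em; case: n' / en. Qed.

Lemma castmxM (F : pzRingType) m m' (e : m = m') (A B : 'M[F]_m) :
  castmx (e, e) (A *m B) = castmx (e, e) A *m castmx (e, e) B.
Proof. by case: m' / e. Qed.

Section Tensor.
Variable F : comPzRingType.

Lemma tensmxDl m n p q (A B : 'M[F]_(m, n)) (C : 'M[F]_(p, q)) :
  (A + B) *t C = A *t C + B *t C.
Proof. by apply/matrixP => i j; rewrite !mxE mulrDl. Qed.

Lemma tensmxDr m n p q (C : 'M[F]_(p, q)) (A B : 'M[F]_(m, n)) :
  C *t (A + B) = C *t A + C *t B.
Proof. by apply/matrixP => i j; rewrite !mxE mulrDr. Qed.

Lemma tensmxZl m n p q c (A : 'M[F]_(m, n)) (B : 'M[F]_(p, q)) :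
  (c *: A) *t B = c *: (A *t B).
Proof. by apply/matrixP => i j; rewrite !mxE mulrA. Qed.

Lemma tensmxZr m n p q c (A : 'M[F]_(m, n)) (B : 'M[F]_(p, q)) :
  A *t (c *: B) = c *: (A *t B).
Proof. by apply/matrixP => i j; rewrite !mxE mulrCA. Qed.

Lemma tensmxNl m n p q (A : 'M[F]_(m, n)) (B : 'M[F]_(p, q)) :
  (- A) *t B = - (A *t B).
Proof. by rewrite -scaleN1r tensmxZl scaleN1r. Qed.

Lemma tensmxNr m n p q (A : 'M[F]_(m, n)) (B : 'M[F]_(p, q)) :
  A *t (- B) = - (A *t B).
Proof. by rewrite -scaleN1r tensmxZr scaleN1r. Qed.

Lemma tensmx11 m n : 1%:M *t 1%:M = 1%:M :> 'M[F]_(m * n).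
Proof.
apply/matrixP => i j; case: (mxtens_indexP i) => i0 i1.
case: (mxtens_indexP j) => j0 j1; rewrite tensmxE !mxE -natrM mulnb.
by rewrite (can_eq (@mxtens_indexK m n)) xpair_eqE.
Qed.

Lemma tensmxA m n p (A : 'M[F]_m) (B : 'M[F]_n) (C : 'M[F]_p) :
  castmx (mulnA m n p, mulnA m n p) (A *t (B *t C)) = A *t B *t C.
Proof.
have assoc (i : 'I_m) (j : 'I_n) (k : 'I_p) :
    cast_ord (esym (mulnA m n p)) (mxtens_index (mxtens_index (i, j), k))
    = mxtens_index (i, mxtens_index (j, k)).
  by apply: val_inj; rewrite /= mulnDl mulnA addnA.
apply/matrixP => i j; rewrite castmxE /=.
case: (mxtens_indexP i) => i01 i2; case: (mxtens_indexP i01) => i0 i1.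
case: (mxtens_indexP j) => j01 j2; case: (mxtens_indexP j01) => j0 j1.
by rewrite !assoc !tensmxE mulrA.
Qed.

(** The copies [a *t b *t 1] and [1 *t a *t b], and likewise for [c] and [d], overlap only in the
    middle factor. There [b] and [d] meet [a] and [c], so the four relations between the copies
    reduce to relations of size [n]. *)
Lemma yang_baxter_quaternion n (k s t : F) (a b c d : 'M[F]_n) :
  let U := s *: (a *t b) in
  let V := t *: (c *t d) in
  U *m U = - 1%:M -> V *m V = - 1%:M -> U *m V = - (V *m U) ->
  a *m b = b *m a -> c *m d = d *m c ->
  b *m c = - (c *m b) -> d *m a = - (a *m d) ->
  yang_baxter (k *: (1%:M + U + V + U *m V)).
Proof.
move=> U V UU VV UV ab cd bc da; rewrite /yang_baxter.
(* Both embeddings are unital algebra morphisms, so each copy inherits the relations of [U] and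
   [V]. *)
pose l (M : 'M[F]_(n * n)) : 'M[F]_(n * n * n) := M *t 1%:M.
pose r (M : 'M[F]_(n * n)) : 'M[F]_(n * n * n) :=
  castmx (mulnA n n n, mulnA n n n) (1%:M *t M).
have lD M N : l (M + N) = l M + l N by exact: tensmxDl.
have rD M N : r (M + N) = r M + r N by rewrite /r tensmxDr castmxD.
have lZ x M : l (x *: M) = x *: l M by exact: tensmxZl.
have rZ x M : r (x *: M) = x *: r M by rewrite /r tensmxZr castmxZ.
have lM M N : l (M *m N) = l M *m l N by rewrite /l tensmx_mul mulmx1.
have rM M N : r (M *m N) = r M *m r N.
  by rewrite /r -castmxM tensmx_mul mulmx1.
have l1 : l 1%:M = 1%:M by exact: tensmx11.
have r1 : r 1%:M = 1%:M by rewrite /r -tensmx11 tensmxA !tensmx11.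
have lN M : l (- M) = - l M by rewrite -scaleN1r lZ scaleN1r.
have rN M : r (- M) = - r M by rewrite -scaleN1r rZ scaleN1r.
have rU : r U = s *: (1%:M *t a *t b) by rewrite rZ /r tensmxA.
have rV : r V = t *: (1%:M *t c *t d) by rewrite rZ /r tensmxA.
rewrite -/(l _) -/(r _) lZ rZ !lD !rD l1 r1 lM rM.
rewrite -!scalemxAl -!scalemxAr -!scalemxAl; do 3 congr (_ *: _).
apply: (@quaternion_braid 'M[F]_(n * n * n)).
- by rewrite -[_ * _]lM UU lN l1.
- by rewrite -[_ * _]lM VV lN l1.
- by rewrite -[_ * _]rM UU rN r1.
- by rewrite -[_ * _]rM VV rN r1.
- by rewrite -[_ * _]lM UV lN lM.
- by rewrite -[_ * _]rM UV rN rM.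
- rewrite rU lZ /l -!mulmxE -!scalemxAl -!scalemxAr !tensmx_mul.
  by rewrite !mulmx1 !mul1mx ab.
- rewrite rV lZ /l -!mulmxE -!scalemxAl -!scalemxAr !tensmx_mul.
  by rewrite !mulmx1 !mul1mx cd.
- rewrite rV lZ /l -!mulmxE -!scalemxAl -!scalemxAr !tensmx_mul.
  rewrite !mulmx1 !mul1mx bc tensmxNr tensmxNl !scalerN.
  by rewrite scalerA mulrC -scalerA.
- rewrite rU lZ /l -!mulmxE -!scalemxAl -!scalemxAr !tensmx_mul.
  rewrite !mulmx1 !mul1mx da tensmxNr tensmxNl !scalerN.
  by rewrite scalerA mulrC -scalerA.
Qed.

End Tensor.

(** The product rule for adjoining a square root [q] of -3; it reduces the quadratic equation and
    unitarity to scalar identities. *)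
Lemma mulmx_pure_quaternion (F : comPzRingType) n (q : 'M[F]_n) (x y s t : F) :
  q *m q = - 3%:R%:M ->
  (x%:M + s *: q) *m (y%:M + t *: q) =
  (x * y - 3%:R * (s * t))%:M + (x * t + s * y) *: q.
Proof.
move=> qq; rewrite mulmxDl !mulmxDr -scalar_mxM mul_scalar_mx scalerA.
rewrite mul_mx_scalar scalerA -scalemxAl -scalemxAr scalerA qq scalerN.
rewrite scale_scalar_mx addrA addrAC (raddfB (@scalar_mx F n)) scalerDl.
rewrite [y * s]mulrC [3%:R * _]mulrC.
by rewrite (addrAC (x * y)%:M) addrA.
Qed.

Lemma cexp_imaginary (R : realType) (x : R) :
  cexp (x%:C * 'i%C) = cos x +i* sin x.
Proof. by rewrite /cexp; simpc; rewrite /= expR0; simpc. Qed.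

Lemma cexp_imaginaryD (R : realType) (x y : R) :
  cexp ((x + y)%:C * 'i%C) = cexp (x%:C * 'i%C) * cexp (y%:C * 'i%C).
Proof.
rewrite !cexp_imaginary cosD sinD; simpc; congr (_ +i* _).
by rewrite addrC.
Qed.

(** * The Pauli matrices and the generators built from them *)

Lemma shiftX_sqr (R : realType) : shiftX R *m shiftX R = 1%:M.
Proof.
apply/matrixP => i j; rewrite !mxE !big_ord_recl big_ord0 !mxE.
move: i j => [[|[|//]] ?] [[|[|//]] ?];
  by rewrite -!val_eqE /= ?mulr0 ?mulr1 ?mul0r ?addr0 ?add0r.
Qed.

Lemma clockZ_sqr (R : realType) : clockZ R *m clockZ R = 1%:M.
Proof.
apply/matrixP => i j; rewrite !mxE !big_ord_recl big_ord0 !mxE.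
move: i j => [[|[|//]] ?] [[|[|//]] ?];
  by rewrite -!val_eqE /= ?mulr0n ?mulr1n ?mulr0 ?mul0r ?addr0 ?add0r
     ?mulrNN ?mulr1.
Qed.

Lemma shiftX_clockZ (R : realType) :
  shiftX R *m clockZ R = - (clockZ R *m shiftX R).
Proof.
apply/matrixP => i j; rewrite !mxE !big_ord_recl !big_ord0 !mxE.
move: i j => [[|[|//]] ?] [[|[|//]] ?];
  by rewrite -!val_eqE /= ?mulr0n ?mulr1n ?mulr0 ?mul0r ?addr0 ?add0r
     ?mulr1 ?mul1r ?oppr0 ?opprK.
Qed.

Lemma shiftX_adj (R : realType) : map_mx Num.conj (shiftX R)^T = shiftX R.
Proof.
apply/matrixP => i j; rewrite !mxE rmorph_nat.
by move: i j => [[|[|//]] ?] [[|[|//]] ?]; rewrite -!val_eqE.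
Qed.

Lemma clockZ_adj (R : realType) : map_mx Num.conj (clockZ R)^T = clockZ R.
Proof.
apply/matrixP => i j; rewrite !mxE rmorphMn rmorphXn rmorphN1.
by move: i j => [[|[|//]] ?] [[|[|//]] ?]; rewrite -!val_eqE.
Qed.

Section Generators.
Variable R : realType.
Let I2 : 'i%C * 'i%C = -1 :> R[i]. Proof. by rewrite -expr2 sqr_i. Qed.

Lemma opPZ_sqr : opPZ R *m opPZ R = 1%:M.
Proof. by rewrite !tensmx_mul !mulmx1 !clockZ_sqr !tensmx11. Qed.

Lemma opPX_sqr : opPX R *m opPX R = 1%:M.
Proof. by rewrite !tensmx_mul !mulmx1 !shiftX_sqr !tensmx11. Qed.

(** Only in the third of the four tensor factors does [shiftX] meet [clockZ], so exactly one sign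
    appears. *)
Lemma opPX_opPZ : opPX R *m opPZ R = - (opPZ R *m opPX R).
Proof.
by rewrite !tensmx_mul !mulmx1 !mul1mx shiftX_clockZ tensmxNl tensmxNr.
Qed.

Lemma opU_sqr : opU R *m opU R = - 1%:M.
Proof. by rewrite -scalemxAl -scalemxAr scalerA I2 opPZ_sqr scaleN1r. Qed.

Lemma opV_sqr : opV R *m opV R = - 1%:M.
Proof. by rewrite -scalemxAl -scalemxAr scalerA I2 opPX_sqr scaleN1r. Qed.

Lemma opU_opV : opU R *m opV R = - (opV R *m opU R).
Proof.
rewrite -[LHS]scalemxAl -[in LHS]scalemxAr -[in RHS]scalemxAl -[in RHS]scalemxAr.
by rewrite opPX_opPZ !scalerN opprK.
Qed.

Lemma opU_adj : map_mx Num.conj (opU R)^T = - opU R.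
Proof.
rewrite /opU linearZ /= map_mxZ /opPZ !trmx_tens !map_mxT !trmx1 !map_mx1.
by rewrite clockZ_adj complexiE /= conjCi scaleNr.
Qed.

Lemma opV_adj : map_mx Num.conj (opV R)^T = - opV R.
Proof.
rewrite /opV linearZ /= map_mxZ /opPX !trmx_tens !map_mxT !trmx1 !map_mx1.
by rewrite shiftX_adj complexiE /= conjCi scaleNr.
Qed.

End Generators.

(* z^3 = i, i.e. z is a root of t^3 + i^3 = (t + i) (t^2 - i t - 1), and z <> -i
   because its real part cos (pi / 6) is positive. *)
Lemma cexp_pi6_sqr (R : realType) (z := cexp ((pi / 6)%:C * 'i%C) : R[i]) :
  z ^+ 2 = 'i%C * z + 1.
Proof.
have z3 : z ^+ 3 = 'i%C.
  rewrite 2!exprS expr1 /z -!cexp_imaginaryD.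
  have -> : pi / 6 + (pi / 6 + pi / 6) = pi / 2 :> R by field.
  by rewrite cexp_imaginary cos_pihalf sin_pihalf.
have I2 : 'i%C * 'i%C = -1 :> R[i] by rewrite -expr2 sqr_i.
have zi0 : z + 'i%C != 0.
  rewrite /z cexp_imaginary; simpc; rewrite eq_complex /= negb_and.
  rewrite gt_eqF // cos_gt0_pihalf //.
  have p0 := pi_gt0 R; apply/andP; split; lra.
apply: (mulfI zi0).
(* Since [ring] treats ['i] as a formal symbol, the vanishing term ['i * 'i + 1] is kept
   explicit. *)
have : (z + 'i%C) * (z ^+ 2 - ('i%C * z + 1)) =
    z ^+ 3 - 'i%C - z * ('i%C * 'i%C + 1) by ring.
rewrite z3 I2 subrr addNr mulr0 subrr => /eqP.
by rewrite mulrBr subr_eq0 => /eqP.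
Qed.

Lemma cexp_imaginary_conj (R : realType) (x : R) :
  cexp (x%:C * 'i%C) * Num.conj (cexp (x%:C * 'i%C)) = 1.
Proof.
rewrite cexp_imaginary.
have -> : Num.conj (cos x +i* sin x) = cos x -i* sin x by [].
by simpc; rewrite -!expr2 cos2Dsin2 mulrC addNr.
Qed.

(* With q = U + V + U V we have q^2 = -3, so the operator c (1 + q) is a root of
   (t - c)^2 + 3 c^2 = t^2 - 2 c t + 4 c^2, which is (t + 1) (t - h). *)
Section QuaternionOperator.
Variables (F : numClosedFieldType) (n m : nat) (c h : F) (U V : 'M[F]_n).
Hypothesis (nE : n = (m + m)%N).
Hypotheses (UU : U *m U = - 1%:M) (VV : V *m V = - 1%:M).
Hypothesis UV : U *m V = - (V *m U).
Hypotheses (c_lin : 2 * c = h - 1) (c_sqr : 4 * (c * c) = - h).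

Let q : 'M[F]_n := U + V + U *m V.
Let A : 'M[F]_n := c *: (1%:M + U + V + U *m V).

Let VU : V *m U = - (U *m V).
Proof. by rewrite UV opprK. Qed.

Let AE : A = c%:M + c *: q.
Proof. by rewrite /A -!addrA scalerDr scalemx1 !addrA. Qed.

Let qq : q *m q = - 3%:R%:M.
Proof.
have := @quaternion_pure_sqr 'M[F]_n U V UU VV UV.
by rewrite -[3%:R%:M]scalemx1 scaler_nat.
Qed.

Lemma quaternion_operator_min_poly : (A + 1%:M) *m (A - h%:M) = 0.
Proof.
have -> : A + 1%:M = (c + 1)%:M + c *: q.
  by rewrite AE (raddfD (@scalar_mx F n)) addrAC.
have -> : A - h%:M = (c - h)%:M + c *: q.
  by rewrite AE (raddfB (@scalar_mx F n)) addrAC.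
rewrite mulmx_pure_quaternion //.
(* Both coefficients are written as combinations of the defects of [c_lin] and [c_sqr]. *)
have -> : (c + 1) * c + c * (c - h) = c * (2 * c - (h - 1)) by ring.
have -> : (c + 1) * (c - h) - 3 * (c * c) =
    - (4 * (c * c) + h) + c * (2 * c - (h - 1)) by ring.
by rewrite c_lin c_sqr addNr oppr0 subrr mulr0 addr0 scale0r addr0 raddf0.
Qed.

(** The adjoint of [q] is [- q], so the product of [A] with its adjoint is [c * Num.conj c] times
    [(1 + q) (1 - q) = 1 - q^2 = 4]. *)
Lemma quaternion_operator_unitary :
  map_mx Num.conj U^T = - U -> map_mx Num.conj V^T = - V ->
  4 * (c * Num.conj c) = 1 -> A \is unitarymx.
Proof.
move=> adjU adjV cc; apply/unitarymxP.
have adjQ : map_mx Num.conj (1%:M + U + V + U *m V)^T = 1%:M - q.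
  rewrite !linearD /= !map_mxD trmx1 map_mx1 trmx_mul map_mxM adjU adjV.
  by rewrite mulmxN mulNmx opprK VU !addrA.
have -> : map_mx Num.conj A^T = (Num.conj c)%:M + (- Num.conj c) *: q.
  by rewrite /A linearZ /= map_mxZ adjQ scalerBr scalemx1 scaleNr.
rewrite AE mulmx_pure_quaternion //.
have -> : c * - Num.conj c + c * Num.conj c = 0 by ring.
rewrite scale0r addr0.
by congr (_%:M); rewrite -[RHS]cc; ring.
Qed.

Lemma quaternion_operator_multiplicities :
  (mup (-1) (char_poly A) = m /\ mup h (char_poly A) = m) /\
  (\rank (eigenspace A^T (-1)) = m /\ \rank (eigenspace A^T h) = m).
Proof.
(* If [h = -1], then [c_lin] gives [4 c^2 = 4] while [c_sqr] gives [4 c^2 = 1]. *)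
have h_neq : -1 != h.
  apply/eqP => h1; move: c_sqr.
  have -> : 4 * (c * c) = (2 * c) * (2 * c) by ring.
  rewrite c_lin -h1 => /eqP; rewrite -subr_eq0.
  have -> : (-1 - 1) * (-1 - 1) - - (-1) = 3%:R :> F by ring.
  by rewrite pnatr_eq0.
have trA : \tr A = (-1) *+ m + h *+ m.
  rewrite AE mxtraceD mxtraceZ !mxtraceD (mxtrace_anticomm VV UV).
  rewrite (mxtrace_anticomm UU VU) (@mxtrace_anticomm _ _ (U *m V) U UU).
    rewrite !addr0 mulr0 addr0 mxtrace_scalar nE -mulrnDl [-1 + h]addrC -c_lin.
    by rewrite mulrnDr -mulrnDl; congr (_ *+ _); ring.
  by rewrite -mulmxA VU mulmxN.
have min_poly := quaternion_operator_min_poly.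
(* The multiplicity lemma treats only the root of the left factor, so it is applied to both orders
   of the factors. *)
have min_polyC : (A - h%:M) *m (A - (-1)%:M) = 0.
  rewrite -min_poly raddfN /= opprK; apply: comm_mxD; last exact: comm_mx1.
  by apply/comm_mx_sym/comm_mxB; last exact: comm_mx_scalar.
have min_poly' : (A - (-1)%:M) *m (A - h%:M) = 0.
  by rewrite (raddfN (@scalar_mx F n)) opprK.
have [mup1 rank1] := two_eigenvalue_multiplicity h_neq nE min_poly' trA.
rewrite addrC in trA; rewrite eq_sym in h_neq.
have [mup2 rank2] := two_eigenvalue_multiplicity h_neq nE min_polyC trA.
exact: (conj (conj mup1 mup2) (conj rank1 rank2)).
Qed.

End QuaternionOperator.

Theorem theorem13p2 (R : realType) :
  let zeta : R[i] := cexp ((pi / 6)%:C * 'i%C) in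
  let h : R[i] := zeta ^+ 2 in
  let U := opU R in
  let V := opV R in
  let A : 'M[R[i]]_((2 * 2) * (2 * 2)) :=
    ('i%C * zeta / 2) *: (1%:M + U + V + U *m V) in
  h = cexp ((pi / 3)%:C * 'i%C) /\
  A \is unitarymx /\
  yang_baxter A /\
  (A + 1%:M) *m (A - h%:M) = 0 /\
  (mup (-1) (char_poly A) = 8 /\ mup h (char_poly A) = 8)%N /\
  (\rank (eigenspace A^T (-1)) = 8 /\ \rank (eigenspace A^T h) = 8)%N.
Proof.
move=> zeta h U V; set c : R[i] := 'i%C * zeta / 2 => A.
have I2 : 'i%C * 'i%C = -1 :> R[i] by rewrite -expr2 sqr_i.
have hE : h = 'i%C * zeta + 1 by exact: cexp_pi6_sqr.
have c2E : 2 * c = 'i%C * zeta by rewrite mulrC mulfVK ?pnatr_eq0.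
(* This and [c_sqr] are the sum and the product of the roots -1 and [h] of [t^2 - 2 c t + 4 c^2]. *)
have c_lin : 2 * c = h - 1 by rewrite hE addrK.
have c_sqr : 4 * (c * c) = - h.
  have -> : 4 * (c * c) = (2 * c) * (2 * c) by ring.
  by rewrite c2E mulrACA I2 mulN1r -expr2.
have cc : 4 * (c * Num.conj c) = 1.
  have -> : 4 * (c * Num.conj c) = (2 * c) * (2 * Num.conj c) by ring.
  (* As 2 is real, the product is that of ['i * zeta] with its conjugate, and both ['i] and [zeta]
     have modulus 1. *)
  rewrite -[X in X * Num.conj c](conjC_nat _ 2) -rmorphM c2E rmorphM mulrACA.
  rewrite cexp_imaginary_conj mulr1.
  by rewrite complexiE /= conjCi mulrN -complexiE I2 opprK.
split.
  rewrite /h /zeta expr2 -cexp_imaginaryD.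
  by have -> : pi / 6 + pi / 6 = pi / 3 :> R by field.
have nE : (2 * 2 * (2 * 2) = 8 + 8)%N by [].
split; first exact: quaternion_operator_unitary (opU_sqr R) (opV_sqr R)
  (opU_opV R) (opU_adj R) (opV_adj R) cc.
split.
  (* Here [a = 1 *t Z], [b = Z *t 1], [c = X *t 1] and [d = X *t X]; each anticommuting pair has a
     single factor where [X] meets [Z]. *)
  apply: yang_baxter_quaternion (opU_sqr R) (opV_sqr R) (opU_opV R) _ _ _ _.
  - by rewrite !tensmx_mul !mulmx1 ?mul1mx.
  - by rewrite !tensmx_mul !mulmx1 ?mul1mx.
  - by rewrite !tensmx_mul !mulmx1 shiftX_clockZ tensmxNl opprK.
  - by rewrite !tensmx_mul !mulmx1 ?mul1mx shiftX_clockZ tensmxNr.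
split; first exact: quaternion_operator_min_poly (opU_sqr R) (opV_sqr R)
  (opU_opV R) c_lin c_sqr.
exact: quaternion_operator_multiplicities nE (opU_sqr R) (opV_sqr R)
  (opU_opV R) c_lin c_sqr.
Qed.
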